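(* Let $B$ be a standard graded artinian $k$-algebra where $k$ is a field of characteristic zero. Then $A=B\otimes_k k[x]/(x^d)$ has the SLP for any $d\geq 1$ if and only if $B$ is almost centered and has the SLP.
   Context: A standard graded artinian $k$-algebra is a finite-dimensional quotient of a polynomial ring over $k$ (all variables of degree $1$) by a homogeneous ideal. Here $x$ is a new variable of degree $1$. $A$ has the strong Lefschetz property (SLP) if there is a linear form $\ell\in A_1$ such that $\cdot\ell^t:A_i\to A_{i+t}$ has full rank (is injective or surjective) for all $i\ge 0$ and $t\geq 1$. Let $h_i=\dim_k A_i$ (so $h_i=0$ for $i<0$ and for $i$ larger than the socle degree). $A$ is almost centered if both: (1) if $h_i<h_j$ for some $i<j$, then $h_{i-s}\leq h_{j+s}$ for any $s\geq 0$; (2) if $h_i>h_j$ for some $i<j$, then $h_{i-s}\geq h_{j+s}$ for any $s\geq 0$. *)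

(* Defs.v *)
From HB Require Import structures.
From mathcomp Require Import all_boot all_order all_algebra all_field.
From mathcomp.multinomials Require Import mpoly.

Set Implicit Arguments.
Unset Strict Implicit.
Unset Printing Implicit Defensive.

Import GRing.Theory.
Local Open Scope ring_scope.

(* The tensor product of two finite-dimensional k-algebras.  The vector space
   B (x) C is modelled by matrices of coordinates with respect to the
   coordinate bases underlying [B] and [C]; [tensor_lift_pure] and
   [tensor_lift_unique] state its universal property, and [tensor_pureM]
   characterizes the product. *)
Definition tensor (k : fieldType) (B C : falgType k) : Type :=
  'M[k]_(dim B, dim C).

Section Tensor.
Import VectorInternalTheory.
Variables (k : fieldType) (B C : falgType k).

HB.instance Definition _ := Vector.copy (tensor B C) 'M[k]_(dim B, dim C).

Definition tensor_pure (b : B) (c : C) : tensor B C := (v2r b)^T *m v2r c.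

Definition bilinear_map (W : lmodType k) (f : B -> C -> W) : Prop :=
  (forall c, linear (f^~ c)) /\ (forall b, linear (f b)).

Definition tensor_lift (W : lmodType k) (f : B -> C -> W) (M : tensor B C) : W :=
  \sum_i \sum_j M i j *: f (r2v (delta_mx 0 i)) (r2v (delta_mx 0 j)).

Lemma tensor_pure_bilinear : bilinear_map tensor_pure.
Proof.
split=> [c|b] a u v; rewrite /tensor_pure linearP /=.
  by rewrite linearP /= mulmxDl -scalemxAl.
by rewrite mulmxDr -scalemxAr.
Qed.

Lemma tensor_lift_linear (W : lmodType k) (f : B -> C -> W) :
  linear (tensor_lift f).
Proof.
move=> a M N; rewrite /tensor_lift scaler_sumr -big_split /=.
apply: eq_bigr => i _; rewrite scaler_sumr -big_split /=.
by apply: eq_bigr => j _; rewrite !mxE scalerDl scalerA.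
Qed.

Lemma tensor_linear_sum (V W : lmodType k) (g : V -> W) (I : finType)
    (a : I -> k) (v : I -> V) : linear g ->
  g (\sum_i a i *: v i) = \sum_i a i *: g (v i).
Proof.
move=> gl; have g0 : g 0 = 0.
  by have := gl (-1) 0 0; rewrite scaler0 addr0 scaleN1r addNr.
apply: (big_rec2 (fun x y => g x = y)) => // i x y _ E.
by rewrite gl E.
Qed.

Lemma coord_sumE (V : falgType k) (v : V) :
  v = \sum_i v2r v 0 i *: r2v (delta_mx 0 i).
Proof.
rewrite -[LHS]v2rK {1}[v2r v]row_sum_delta linear_sum /=.
by apply: eq_bigr => i _; rewrite linearZ.
Qed.

Lemma tensor_lift_pure (W : lmodType k) (f : B -> C -> W) b c :
  bilinear_map f -> tensor_lift f (tensor_pure b c) = f b c.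
Proof.
move=> [fl fr]; rewrite {2}[b]coord_sumE (tensor_linear_sum _ _ (fl c)).
apply: eq_bigr => i _; rewrite {2}[c]coord_sumE (tensor_linear_sum _ _ (fr _)).
rewrite scaler_sumr; apply: eq_bigr => j _.
by rewrite scalerA /tensor_pure !mxE big_ord1 !mxE.
Qed.

Lemma tensor_lift_id (M : tensor B C) : tensor_lift tensor_pure M = M.
Proof.
rewrite [RHS]matrix_sum_delta; apply: eq_bigr => i _; apply: eq_bigr => j _.
congr (_ *: _); rewrite /tensor_pure !r2vK trmx_delta.
by rewrite mul_delta_mx.
Qed.

Lemma tensor_lift_unique (W : lmodType k) (g h : tensor B C -> W) :
  linear g -> linear h ->
  (forall b c, g (tensor_pure b c) = h (tensor_pure b c)) -> g =1 h.
Proof.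
move=> gl hl E M; rewrite -(tensor_lift_id M) /tensor_lift !pair_big /=.
by rewrite !tensor_linear_sum //; apply: eq_bigr => -[i j] _; rewrite E.
Qed.

Definition tensor_pure_mul (N : tensor B C) (b : B) (c : C) : tensor B C :=
  tensor_lift (fun b' c' => tensor_pure (b * b') (c * c')) N.

Definition tensor_mul (M N : tensor B C) : tensor B C :=
  tensor_lift (tensor_pure_mul N) M.

Definition tensor_one : tensor B C := tensor_pure 1 1.

Let pureDl c b b' a : tensor_pure (a *: b + b') c =
  a *: tensor_pure b c + tensor_pure b' c.
Proof. exact: (proj1 tensor_pure_bilinear _ _ _ _). Qed.
Let pureDr c c' b a : tensor_pure b (a *: c + c') =
  a *: tensor_pure b c + tensor_pure b c'.
Proof. exact: (proj2 tensor_pure_bilinear _ _ _ _). Qed.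

Let inner_bilinear b c :
  bilinear_map (fun b' c' => tensor_pure (b * b') (c * c')).
Proof.
split=> x a u v; rewrite mulrDr -scalerAr; first exact: pureDl.
exact: pureDr.
Qed.

Let outer_bilinear N : bilinear_map (tensor_pure_mul N).
Proof.
split=> x a u v; rewrite /tensor_pure_mul /tensor_lift scaler_sumr -big_split /=;
  apply: eq_bigr => i _; rewrite scaler_sumr -big_split /=;
  apply: eq_bigr => j _; rewrite mulrDl -scalerAl.
  by rewrite pureDl scalerDr !scalerA mulrC.
by rewrite pureDr scalerDr !scalerA mulrC.
Qed.

Let mul_pure b c b' c' :
  tensor_mul (tensor_pure b c) (tensor_pure b' c') =
  tensor_pure (b * b') (c * c').
Proof.
by rewrite /tensor_mul tensor_lift_pure // /tensor_pure_mul tensor_lift_pure.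
Qed.

Let mull N : linear (tensor_mul^~ N).
Proof. exact: tensor_lift_linear. Qed.

Let mulr M : linear (tensor_mul M).
Proof.
move=> a u v; rewrite /tensor_mul /tensor_lift scaler_sumr -big_split /=.
apply: eq_bigr => i _; rewrite scaler_sumr -big_split /=.
apply: eq_bigr => j _.
by rewrite /tensor_pure_mul tensor_lift_linear scalerDr !scalerA mulrC.
Qed.

Let linear_comp (U V W : lmodType k) (g : V -> W) (f : U -> V) :
  linear g -> linear f -> linear (fun x => g (f x)).
Proof. by move=> gl fl a u v; rewrite fl gl. Qed.

Fact tensor_mulA : associative tensor_mul.
Proof.
move=> M N P; move: M; apply: tensor_lift_unique => [||b c].
- exact: mull.
- exact: (linear_comp (mull P) (mull N)).
move: N; apply: tensor_lift_unique => [||b' c'].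
- exact: (linear_comp (mulr _) (mull P)).
- exact: (linear_comp (mull P) (mulr _)).
move: P; apply: tensor_lift_unique => [||b'' c''].
- exact: (linear_comp (mulr _) (mulr _)).
- exact: mulr.
by rewrite !mul_pure !mulrA.
Qed.

Fact tensor_mul1 : left_id tensor_one tensor_mul.
Proof.
apply: tensor_lift_unique => [||b c]; [exact: mulr | by [] |].
by rewrite mul_pure !mul1r.
Qed.

Fact tensor_mulr1 : right_id tensor_one tensor_mul.
Proof.
apply: (@tensor_lift_unique _ (tensor_mul^~ tensor_one)) => [||b c].
- exact: mull.
- by [].
by rewrite mul_pure !mulr1.
Qed.

Fact tensor_mulDl : left_distributive tensor_mul +%R.
Proof. by move=> M N P; have := mull P 1 M N; rewrite !scale1r. Qed.

Fact tensor_mulDr : right_distributive tensor_mul +%R.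
Proof. by move=> M N P; have := mulr M 1 N P; rewrite !scale1r. Qed.

Fact tensor_one_neq0 : tensor_one != 0.
Proof.
have /rV0Pn[i bi] : v2r (1 : B) != 0.
  apply: contraNneq (oner_neq0 B) => E.
  by rewrite -[1](@v2rK _ B) E linear0.
have /rV0Pn[j cj] : v2r (1 : C) != 0.
  apply: contraNneq (oner_neq0 C) => E.
  by rewrite -[1](@v2rK _ C) E linear0.
apply/eqP => /matrixP/(_ i j)/eqP; rewrite !mxE big_ord1 mxE.
by rewrite mulf_eq0 (negPf bi) (negPf cj).
Qed.

HB.instance Definition _ := GRing.Zmodule_isNzRing.Build (tensor B C)
  tensor_mulA tensor_mul1 tensor_mulr1 tensor_mulDl tensor_mulDr
  tensor_one_neq0.

Fact tensor_scaleAl (a : k) (M N : tensor B C) : a *: (M * N) = a *: M * N.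
Proof.
by have := mull N a M 0; rewrite (mul0r N : tensor_mul 0 N = 0) !addr0.
Qed.

HB.instance Definition _ := GRing.Lmodule_isLalgebra.Build k (tensor B C)
  tensor_scaleAl.

Fact tensor_scaleAr (a : k) (M N : tensor B C) : a *: (M * N) = M * (a *: N).
Proof.
by have := mulr M a N 0; rewrite (mulr0 M : tensor_mul M 0 = 0) !addr0.
Qed.

HB.instance Definition _ := GRing.Lalgebra_isAlgebra.Build k (tensor B C)
  tensor_scaleAr.

HB.instance Definition _ := Algebra_isFalgebra.Build k (tensor B C).

Lemma tensor_pureM b c b' c' :
  tensor_pure b c * tensor_pure b' c' = tensor_pure (b * b') (c * c').
Proof. exact: mul_pure. Qed.

Lemma tensor_pure1 : tensor_pure 1 1 = 1 :> tensor B C.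
Proof. by []. Qed.

End Tensor.

HB.instance Definition _ (k : fieldType) (h : {poly k}) :=
  Vector.on {poly %/ h}.

(* [gr i] is the degree i component of the finite-dimensional algebra [B]:
   up to isomorphism, B is the quotient of a polynomial ring by the kernel of
   [pi], which is required to be a homogeneous ideal, i.e. to contain all the
   homogeneous components of its elements. *)
Definition standard_graded (k : fieldType) (B : falgType k)
    (gr : nat -> {vspace B}) : Prop :=
  exists (n : nat) (pi : {lrmorphism {mpoly k[n]} -> B}),
    [/\ forall b, exists p, pi p = b,
        forall p, pi p = 0 -> forall i, pi (pihomog mdeg i p) = 0 &
        forall i b, b \in gr i <-> exists2 p, p \is i.-homog & pi p = b].

(* The grading of k[x]/(x^d), with x in degree 1; since x^d = 0, the degree i
   component is spanned by the class of x^i also when i >= d. *)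
Definition truncated_grading (k : fieldType) (d i : nat) :
    {vspace {poly %/ ('X^d : {poly k})}} := <['qX ^+ i]>%VS.

Definition tensor_vspace (k : fieldType) (B C : falgType k)
    (U : {vspace B}) (V : {vspace C}) : {vspace tensor B C} :=
  <<[seq tensor_pure u v | u <- vbasis U, v <- vbasis V]>>%VS.

Definition tensor_grading (k : fieldType) (B C : falgType k)
    (gB : nat -> {vspace B}) (gC : nat -> {vspace C}) (i : nat) :
    {vspace tensor B C} :=
  (\sum_(j < i.+1) tensor_vspace (gB j) (gC (i - j)%N))%VS.

Definition full_rank_on (k : fieldType) (A : falgType k) (f : A -> A)
    (U V : {vspace A}) : Prop :=
  {in U &, injective f} \/ (forall b, b \in V -> exists2 a, a \in U & f a = b).

Definition strong_lefschetz (k : fieldType) (A : falgType k)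
    (gr : nat -> {vspace A}) : Prop :=
  exists2 l, l \in gr 1%N &
    forall i t : nat, (1 <= t)%N ->
      full_rank_on (fun a => l ^+ t * a) (gr i) (gr (i + t)%N).

(* The Hilbert function, extended by 0 to negative degrees. *)
Definition hilbert (k : fieldType) (A : falgType k)
    (gr : nat -> {vspace A}) (i : int) : nat :=
  if i is Posz n then (\dim (gr n))%N else 0%N.

Definition almost_centered (k : fieldType) (A : falgType k)
    (gr : nat -> {vspace A}) : Prop :=
  let h := hilbert gr in
  (forall i j : int, i < j -> (h i < h j)%N ->
     forall s : nat, (h (i - s%:Z)%R <= h (j + s%:Z)%R)%N) /\
  (forall i j : int, i < j -> (h i > h j)%N ->
     forall s : nat, (h (i - s%:Z)%R >= h (j + s%:Z)%R)%N).

(* Main.v *)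
(* After rescaling x, a Lefschetz element of A has the form l + x with l in
   degree 1 of B (the coefficient of x cannot vanish when d > 1).  For U(l, x)
   homogeneous with coefficients in k and b in B, multiplication by (l + x)^t
   sends U b to ((l + x)^t U) b, so it is governed by multiplication by
   (x + 1)^t on k[x].  In characteristic zero the coefficients of (x + 1)^t U
   in any window T, ..., T + n - 1 with T <= t can be prescribed by a unique U
   of degree < n.  Such windows show two things.
   - Suppose that, for some m, l^(j - i) : B_i -> B_j is injective when
     i + j <= m and surjective when i + j > m (including B_(-1) = 0).  Then
     l + x has the same property on A, with m + d - 1 in place of m.
   - Suppose that, for some i + j = i' + j', l^(j - i) fails to be injective on
     B_i and l^(j' - i') fails to be surjective onto B_(j').  Then, for d
     large, some power of l + x is neither injective nor surjective on A.
   If B has the SLP, then the existence of m amounts to a property of the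
   Hilbert function, namely almost centeredness. *)

Require Import Defs.
From HB Require Import structures.
From mathcomp Require Import all_boot all_order all_algebra all_field.
From mathcomp.multinomials Require Import mpoly.
From mathcomp Require Import zify.
From Stdlib Require Import Classical_Prop.

Set Implicit Arguments.
Unset Strict Implicit.
Unset Printing Implicit Defensive.

Import GRing.Theory.
Local Open Scope ring_scope.

(** * Windows of coefficients of [('X + 1) ^+ t * U] *)

Section Window.
Variables (k : fieldType) (k_char0 : [pchar k] =i pred0).

Lemma dvdp_exp_derivn (p q : {poly k}) (t T : nat) :
  p ^+ t %| q -> p ^+ (t - T) %| q^`(T).
Proof.
elim: T => [|T IH] dvd; first by rewrite subn0.
rewrite derivnS subnS; have /dvdpP[r ->] := IH dvd.
case: (t - T)%N => [|n]; first by rewrite dvd1p.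
rewrite derivM deriv_exp /= dvdp_add //.
  by rewrite exprS mulrA dvdp_mull.
by rewrite mulrnAr -mulrnAl mulrA dvdp_mull.
Qed.

(* If the window of [F = ('X + 1) ^+ t * U] at [T] vanishes, then ['X^n] and
   [('X + 1) ^+ (t - T)] both divide [F^`(T)], whose degree is too small. *)
Lemma window0 (t T n : nat) (U : {poly k}) :
  (T <= t)%N -> (size U <= n)%N ->
  (forall q, (q < n)%N -> (('X + 1) ^+ t * U)`_(T + q) = 0) -> U = 0.
Proof.
move=> leTt sU F0; set F := _ * U in F0.
have natk m : (m%:R == 0 :> k) = (m == 0)%N by move/pcharf0P: k_char0 => ->.
have X1E : 'X + 1 = 'X - (-1)%:P :> {poly k} by rewrite polyCN opprK.
have sX m : size (('X + 1 : {poly k}) ^+ m) = m.+1.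
  by rewrite X1E size_exp_XsubC.
have nz m : ('X + 1 : {poly k}) ^+ m != 0 by rewrite -size_poly_eq0 sX.
have sF : (size F <= t + n)%N.
  apply: leq_trans (size_polyMleq _ _) _.
  by rewrite sX addSn /= leq_add2l.
have D0 : F^`(T) = 0.
  have E : F^`(T) = drop_poly n F^`(T) * 'X^n.
    rewrite -[LHS](poly_take_drop n) [take_poly _ _](_ : _ = 0) ?add0r //.
    apply/polyP=> q; rewrite coef_take_poly coef0; case: ifP => // ltq.
    by rewrite coef_derivn F0 ?mul0rn.
  have := dvdp_exp_derivn T (dvdp_mulr U (dvdpp (('X + 1) ^+ t))).
  rewrite -/F E Gauss_dvdpl; last first.
    apply/coprimep_expl/coprimep_expr.
    by rewrite X1E coprimep_sym coprimep_XsubC rootE hornerX oppr_eq0 oner_eq0.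
  set Q := drop_poly _ _; have [-> _|nzQ /(dvdp_leq nzQ)] := eqVneq Q 0.
    by rewrite mul0r.
  have sD : (size F^`(T) <= t + n - T)%N.
    apply/leq_sizeP=> j lej; rewrite coef_derivn nth_default ?mul0rn //.
    by apply: leq_trans sF _; lia.
  rewrite sX size_drop_poly ltn_subRL => /leq_trans /(_ sD).
  by move=> ?; exfalso; lia.
(* In characteristic zero the vanishing [T]-th derivative forces [F] to have degree below [T <= t],
   although [F] is a multiple of a polynomial of degree [t]. *)
have sF' : (size F <= T)%N.
  apply/leq_sizeP=> j lej; move/polyP/(_ (j - T)%N): D0.
  rewrite coef_derivn coef0 subnKC // => /eqP.
  rewrite -mulr_natr mulf_eq0 natk => /orP[/eqP //|].
  by rewrite -leqn0 leqNgt ffact_gt0 lej.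
have [//|nzU] := eqVneq U 0.
have := dvdp_leq (mulf_neq0 (nz t) nzU) (dvdp_mulr U (dvdpp _)).
rewrite sX -/F => /leq_trans /(_ sF').
by rewrite ltnNge leTt.
Qed.

(** Reading off the window is a square linear system in the [n] coefficients of [U]. By [window0] it
    is injective, hence invertible. *)
Lemma window_exists (t T n : nat) (v : nat -> k) : (T <= t)%N ->
  exists2 U : {poly k}, (size U <= n)%N &
    forall q, (q < n)%N -> (('X + 1) ^+ t * U)`_(T + q) = v q.
Proof.
move=> leTt.
pose f (u : 'rV[k]_n) : 'rV[k]_n := \row_q (('X + 1) ^+ t * rVpoly u)`_(T + q).
have f_lin : linear f.
  move=> a u w; apply/rowP=> q; rewrite !mxE linearP /= mulrDr coefD.
  by rewrite -scalerAr coefZ.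
pose fL : {linear 'rV[k]_n -> 'rV[k]_n} :=
  HB.pack f (GRing.isLinear.Build _ _ _ _ f f_lin).
have fE u : u *m lin1_mx fL = f u by rewrite mul_rV_lin1.
have fU : lin1_mx fL \in unitmx.
  rewrite -row_free_unit -kermx_eq0; apply/rowV0P=> u /sub_kermxP.
  rewrite fE => f0; rewrite -[u]rVpolyK (_ : rVpoly u = 0) ?linear0 //.
  apply: (window0 leTt (size_poly _ _)) => q ltq.
  by have /rowP/(_ (Ordinal ltq)) := f0; rewrite !mxE.
pose u := (\row_q v (q : 'I_n)) *m invmx (lin1_mx fL).
exists (rVpoly u) => [|q ltq]; first exact: size_poly.
have : f u = \row_q v (q : 'I_n) by rewrite -fE mulmxKV.
by move/rowP/(_ (Ordinal ltq)); rewrite !mxE.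
Qed.

(* For [t <= T] the power ['X^(T - t)] already has the required window. *)
Lemma window_unit (t T n : nat) : exists g (U : {poly k}),
  [/\ (size U <= g.+1)%N, g = (if t <= T then T - t else n)%N,
      (('X + 1) ^+ t * U)`_T = 1 &
      forall q, (0 < q <= n)%N -> (('X + 1) ^+ t * U)`_(T + q) = 0].
Proof.
have [letT|ltTt] := leqP t T.
  exists (T - t)%N, 'X^(T - t); rewrite size_polyXn; split=> //.
    rewrite coefMXn ltnNge leq_subr /= subKn //.
    have /monicP : ('X + 1 : {poly k}) ^+ t \is monic.
      by rewrite monic_exp // -[1]opprK -polyCN monicXsubC.
    rewrite lead_coefE -[1]opprK -polyCN.
    by rewrite (size_exp_XsubC t (-1 : k)).
  move=> q /andP[q0 _];
    rewrite coefMXn ltnNge (leq_trans (leq_subr _ _)) ?leq_addr //=.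
  rewrite nth_default // -[1]opprK -polyCN (size_exp_XsubC t (-1 : k)); lia.
have [U sU E] := window_exists n.+1 (fun q => (q == 0)%:R) (ltnW ltTt).
exists n, U; split=> //; first by rewrite -[T in _`_T]addn0 E.
by move=> q /andP[q0 leq]; rewrite E ?ltnS // -(prednK q0).
Qed.

(** The window of ['X^r] is cancelled by a polynomial of degree less than [r], which leaves the
    leading coefficient alone. *)
Lemma window_monic (t T r : nat) : (T <= t)%N ->
  exists U : {poly k}, [/\ (size U <= r.+1)%N, U`_r = 1 &
    forall q, (q < r)%N -> (('X + 1) ^+ t * U)`_(T + q) = 0].
Proof.
move=> leTt.
have [U sU E] := window_exists r
  (fun q => - (('X + 1) ^+ t * 'X^r)`_(T + q)) leTt.
exists (U + 'X^r); split=> [||q ltq].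
- by rewrite (leq_trans (size_polyD _ _)) // size_polyXn geq_max leqnn andbT
  leqW.
- by rewrite coefD coefXn eqxx nth_default ?add0r.
- by rewrite mulrDr coefD E // addNr.
Qed.
End Window.

(** * Almost centered functions and their center *)

Section AlmostCentered.
Variable h : int -> nat.
Hypothesis h_neg : forall i, (i < 0)%R -> h i = 0%N.
Hypothesis h_up : forall i j : int, (i < j)%R -> (h i < h j)%N ->
  forall s : nat, (h (i - s%:Z)%R <= h (j + s%:Z)%R)%N.
Hypothesis h_down : forall i j : int, (i < j)%R -> (h i > h j)%N ->
  forall s : nat, (h (i - s%:Z)%R >= h (j + s%:Z)%R)%N.

(* A valley [e] between [i] and [j] reproduces itself to the left of [i],
   and [h] vanishes in negative degrees. *)
Lemma no_valley (i e j : int) : (i < e)%R -> (e < j)%R ->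
  (h e < h j)%N -> (h i <= h e)%N.
Proof.
move=> ltie ltej hej.
suff H (n : nat) : forall i : int, (i < e)%R -> (i < n%:Z)%R ->
    (h i <= h e)%N.
  by apply: (H (absz i).+1) => //; lia.
elim: n => [|n IH] {ltie}i ltie ltin; first by rewrite h_neg.
rewrite leqNgt; apply/negP => hei.
have := h_down ltie hei (absz (j - e)).
rewrite (_ : e + _ = j); last by lia.
have : (h (i - (absz (j - e))%:Z)%R <= h e)%N by apply: IH; lia.
lia.
Qed.

(** Otherwise the pair with the larger left end is widened, keeping its sum, until both pairs start
    at the same point. Almost centeredness preserves its rise or drop weakly, and comparing the
    right ends then produces a valley. *)
Lemma drop_after_rise (i j i' j' : int) :
  (i < j)%R -> (h i < h j)%N -> (i' < j')%R -> (h i' > h j')%N ->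
  (i + j < i' + j')%R.
Proof.
move=> ltij hij ltij' hij'; rewrite Order.TotalTheory.ltNge; apply/negP => le.
have [leii|ltii] := Order.TotalTheory.leP i' i.
  pose j2 : int := i + j - i'.
  have h2 : (h i' <= h j2)%N.
    have := h_up ltij hij (absz (i - i')).
    rewrite (_ : i - _ = i'); last by lia.
    by rewrite (_ : j + _ = j2) // /j2; lia.
  have [E|ltj] := eqVneq j2 j'; first by rewrite E leqNgt hij' in h2.
  have := @no_valley i' j' j2 ltij' _ (leq_trans hij' h2).
  by rewrite leqNgt hij' => H; apply: notF; apply: H; rewrite /j2 in ltj *; lia.
pose v : int := i' + j' - i.
have h2 : (h v <= h i)%N.
  have := h_down ltij' hij' (absz (i' - i)).
  rewrite (_ : i' - _ = i); last by lia.
  by rewrite (_ : j' + _ = v) // /v; lia.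
have hv := leq_ltn_trans h2 hij.
have [E|ltv] := eqVneq v j; first by rewrite E ltnn in hv.
have A : (h j' <= h v)%N.
  by apply: (no_valley (j := j)) hv; rewrite /v in ltv *; lia.
have : (h i' <= h j')%N.
  by apply: (no_valley ltij' (j := j)) (leq_ltn_trans A hv);
    rewrite /v in ltv *; lia.
by rewrite leqNgt hij'.
Qed.

(** Take [m] least such that no pair of sum greater than [m] rises. If [m > 0], minimality gives a
    rise of sum at least [m], so by [drop_after_rise] no pair of sum at most [m] drops. *)
Lemma almost_centered_center (N : nat) :
  (forall i : int, (N%:Z <= i)%R -> h i = 0%N) ->
  exists m : nat, forall i j : int, (i < j)%R ->
    ((i + j <= m%:Z)%R -> (h i <= h j)%N) /\
    ((m%:Z < i + j)%R -> (h j <= h i)%N).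
Proof.
move=> h_big.
pose bound (m : nat) := forall i j : int, (i < j)%R -> (m%:Z < i + j)%R ->
  (h j <= h i)%N.
have [m [bm min_m]] : exists m, bound m /\ (m = 0%N \/ ~ bound m.-1).
  have: bound (N + N)%N by move=> i j ltij lt; rewrite h_big //; lia.
  elim: (N + N)%N => [|n IH] bn; first by exists 0%N; auto.
  by have [/IH//|nb] := classic (bound n); exists n.+1; auto.
exists m => i j ltij; split; last exact: bm.
move=> le; rewrite leqNgt; apply/negP => hij.
(* For [m = 0], a pair [i < j] of sum at most 0 starts in negative degree, where [h] vanishes and
   cannot drop. *)
case: min_m => [m0|nb].
  have i0 : (i < 0)%R by lia.
  by rewrite (h_neg i0) in hij.
apply: nb => i' j' ltij' lt'; rewrite leqNgt; apply/negP => hij'.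
have := drop_after_rise ltij' hij' ltij hij; lia.
Qed.
End AlmostCentered.

(** * Coefficients in [k[x]/(x^d)] *)

Section TruncatedPolynomials.
Variables (k : fieldType) (d : nat).
Hypothesis d_gt0 : (0 < d)%N.
Local Notation C := {poly %/ ('X^d : {poly k})}.

Lemma coef_in_qpolyXn (p : {poly k}) z :
  (in_qpoly 'X^d p : {poly k})`_z = if (z < d)%N then p`_z else 0.
Proof.
(* [mk_monic] would turn ['X^0] into ['X]; for [d > 0] the modulus really is ['X^d], and reduction
   is truncation. *)
rewrite /= mk_monic_Xn prednK // -Pdiv.RingMonic.take_poly_rmodp.
by rewrite coef_take_poly.
Qed.

Lemma coef_qpolyXn_big (c : C) z : (d <= z)%N -> (c : {poly k})`_z = 0.
Proof.
move=> ledz; rewrite nth_default // (leq_trans _ ledz) //.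
have sX : size (mk_monic ('X^d : {poly k})) = d.+1.
  by rewrite mk_monic_Xn size_polyXn prednK.
by rewrite -ltnS -sX size_mk_monic.
Qed.

Lemma coef_qX (j z : nat) :
  (('qX ^+ j : C) : {poly k})`_z = ((z < d) && (z == j))%N%:R.
Proof. by rewrite -rmorphXn coef_in_qpolyXn coefXn; case: ifP. Qed.

Lemma coef_qXM (c : C) z :
  (('qX * c : C) : {poly k})`_z =
  if (0 < z < d)%N then (c : {poly k})`_z.-1 else 0.
Proof.
have cE : c = in_qpoly _ (c : {poly k}).
  apply: val_inj; apply/polyP => i; rewrite coef_in_qpolyXn.
  by case: ltnP => // ?; rewrite coef_qpolyXn_big.
rewrite {1}cE -rmorphM coef_in_qpolyXn coefXM.
by case: z => [|z] //=; rewrite if_same.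
Qed.

End TruncatedPolynomials.

Lemma tensor_pure0l (k : fieldType) (B C : falgType k) (c : C) :
  tensor_pure (0 : B) c = 0.
Proof.
have := (tensor_pure_bilinear B C).1 c (-1) 0 0.
by rewrite scaler0 addr0 scaleN1r addNr.
Qed.

Lemma tensor_pureZl (k : fieldType) (B C : falgType k) (b : B) (c : C) a :
  tensor_pure (a *: b) c = a *: tensor_pure b c.
Proof.
have := (tensor_pure_bilinear B C).1 c a b 0.
by rewrite tensor_pure0l !addr0.
Qed.

(** * Elements of [A] as polynomials in [x] of degree less than [d] over [B] *)

Section Coefficients.
Variables (k : fieldType) (B : falgType k) (d : nat).
Hypothesis d_gt0 : (0 < d)%N.
Local Notation C := {poly %/ ('X^d : {poly k})}.
Local Notation A := (tensor B C).

Fact coefA_bilinear z :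
  bilinear_map (fun (b : B) (c : C) => (c : {poly k})`_z *: b).
Proof.
split=> x a u v /=; first by rewrite scalerDr !scalerA mulrC.
by rewrite coefD coefZ scalerDl scalerA.
Qed.

Definition coefA (z : nat) : A -> B :=
  tensor_lift (fun (b : B) (c : C) => (c : {poly k})`_z *: b).

HB.instance Definition _ z :=
  GRing.isLinear.Build k A B _ (coefA z) (tensor_lift_linear _).

Lemma coefA_pure z b (c : C) :
  coefA z (tensor_pure b c) = (c : {poly k})`_z *: b.
Proof. exact/tensor_lift_pure/coefA_bilinear. Qed.

Definition polyA (f : nat -> B) : A :=
  \sum_(z < d) tensor_pure (f z) ('qX ^+ z).

Lemma coefA_polyA f z : (z < d)%N -> coefA z (polyA f) = f z.
Proof.
move=> ltz; rewrite linear_sum (bigD1 (Ordinal ltz)) //= coefA_pure.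
rewrite coef_qX // ltz eqxx scale1r big1 ?addr0 // => i nei.
rewrite coefA_pure coef_qX // ltz; case: eqP => [E|]; last by rewrite scale0r.
by case/eqP: nei; apply: val_inj.
Qed.

Lemma coefAK a : polyA (coefA^~ a) = a.
Proof.
pose g (a : A) := polyA (coefA^~ a).
have [bl1 bl2] := tensor_pure_bilinear B C.
rewrite -[LHS]/(g a);
  apply: tensor_lift_unique (g) id _ _ _ a => // [x u v|b c].
  rewrite /g /polyA scaler_sumr -big_split; apply: eq_bigr => z _ /=.
  by rewrite linearP bl1.
have cE : c = \sum_(z < d) (c : {poly k})`_z *: 'qX ^+ z.
  apply: val_inj; apply/polyP => i;
    rewrite [\val (bigop.body _ _ _)]poly_of_qpoly_sum coef_sum /=.
  have [ltid|leid] := ltnP i d; last first.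
    rewrite coef_qpolyXn_big // big1 // => z _.
    by rewrite coefZ coef_qX // ltnNge leid mulr0.
  rewrite (bigD1 (Ordinal ltid)) //= coefZ coef_qX // ltid eqxx mulr1.
  rewrite big1 ?addr0 // => z nez; rewrite coefZ coef_qX // ltid.
  case: eqP => [E|]; last by rewrite mulr0.
  by case/eqP: nez; apply: val_inj.
rewrite [in RHS]cE (tensor_linear_sum _ _ (bl2 b)) /g /polyA.
by apply: eq_bigr => z _; rewrite coefA_pure tensor_pureZl.
Qed.

Lemma coefA_inj a a' :
  (forall z, (z < d)%N -> coefA z a = coefA z a') -> a = a'.
Proof.
move=> E; rewrite -[a]coefAK -[a']coefAK; apply: eq_bigr => z _.
by rewrite E.
Qed.

Definition lin_form (l : B) (c : k) : A :=
  tensor_pure l 1 + c *: tensor_pure 1 'qX.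

Lemma coefA_lin_form l c a z : (z < d)%N ->
  coefA z (lin_form l c * a) =
  l * coefA z a + c *: (if z is z'.+1 then coefA z' a else 0).
Proof.
move=> ltz.
pose f a := coefA z (lin_form l c * a).
pose g a := l * coefA z a + c *: (if z is z'.+1 then coefA z' a else 0).
rewrite -[LHS]/(f a) -[RHS]/(g a);
  apply: tensor_lift_unique => [x u v|x u v|b e].
- by rewrite /f mulrDr -scalerAr linearP.
- rewrite /g linearP mulrDr -scalerAr !scalerDr addrACA; congr (_ + _ + _).
  by case: (z) => [|z'];
    rewrite ?linearP ?scaler0 ?addr0 // scalerDr !scalerA mulrC.
rewrite /f /g /lin_form mulrDl -scalerAl !tensor_pureM !mul1r linearD linearZ
  /=.
rewrite !coefA_pure scalerAr coef_qXM //.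
by case: z ltz {f g} => [|z] ltz /=; rewrite ?coefA_pure ?scale0r // ltz.
Qed.
End Coefficients.

(** * The grading of [A], coefficient by coefficient *)

Section Grading.
Variables (k : fieldType) (B : falgType k) (gr : nat -> {vspace B}) (d : nat).
Hypothesis d_gt0 : (0 < d)%N.
Local Notation C := {poly %/ ('X^d : {poly k})}.
Local Notation A := (tensor B C).
Local Notation grA := (tensor_grading gr (truncated_grading k d)).

Lemma memv_tensor_vspace (B' C' : falgType k) (U : {vspace B'})
    (V : {vspace C'}) u v :
  u \in U -> v \in V -> tensor_pure u v \in tensor_vspace U V.
Proof.
move=> uU vV; have [bl1 bl2] := tensor_pure_bilinear B' C'.
rewrite (coord_vbasis uU) (tensor_linear_sum _ _ (bl1 v)).
apply: rpred_sum => i _; rewrite rpredZ // (coord_vbasis vV).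
rewrite (tensor_linear_sum _ _ (bl2 _)); apply: rpred_sum => j _.
rewrite rpredZ // memv_span //; apply: allpairs_f.
  by rewrite mem_nth // size_tuple.
by rewrite mem_nth // size_tuple.
Qed.

(* The coefficients of [x ^ z] of the elements of degree [i]. *)
Definition gr_sub (i z : nat) : {vspace B} :=
  if (z <= i)%N then gr (i - z) else 0%VS.

Lemma mem_tensor_grading i (a : A) :
  a \in grA i <-> forall z, (z < d)%N -> coefA z a \in gr_sub i z.
Proof.
split=> [a_in z ltz|a_in].
  have -> : coefA z a = linfun (coefA z) a by rewrite lfunE.
  rewrite memv_preim; move: a a_in; apply/subvP/subv_sumP => j _.
  apply/span_subvP => _ /allpairsP[[u v] [/= /vbasis_mem uU /vbasis_mem vV ->]].
  rewrite -memv_preim lfunE /= coefA_pure.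
  have [c ->] := vlineP _ _ vV; rewrite coefZ coef_qX // ltz.
  case: eqP => [E|_]; last by rewrite mulr0 scale0r mem0v.
  have leji : (j <= i)%N by rewrite -ltnS ltn_ord.
  by rewrite rpredZ // /gr_sub E leq_subr subKn.
rewrite -[a](coefAK d_gt0) /polyA; apply: rpred_sum => z _.
have := a_in z (ltn_ord z); rewrite /gr_sub; case: leqP => [lez caz|_];
  last first.
  by rewrite memv0 => /eqP ->; rewrite tensor_pure0l mem0v.
have lt : (i - z < i.+1)%N by rewrite ltnS leq_subr.
apply: subvP (sumv_sup (Ordinal lt) isT (subvv _)) _ _.
by apply: memv_tensor_vspace => //=; rewrite subKn // memv_line.
Qed.
End Grading.

(** * Graded pieces of a standard graded algebra *)

Section StandardGraded.
Variables (k : fieldType) (B : falgType k) (gr : nat -> {vspace B}).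
Hypothesis B_std : standard_graded gr.

Lemma gr0E b : b \in gr 0 <-> exists c : k, b = c%:A.
Proof.
have [n [pi [_ _ grP]]] := B_std; split=> [/grP[p p0 <-]|[c ->]].
  have {1}-> : p = p@_0%MM *: 1; last by exists p@_0%MM;
    rewrite linearZ rmorph1.
  apply/mpolyP => m; rewrite mcoeffZ mcoeff1.
  have [->|nem] := eqVneq m 0%MM; first by rewrite mulr1.
  by rewrite mulr0 (dhomog_nemf_coeff p0) // mdeg_eq0.
by apply/grP; exists (c *: 1); rewrite ?linearZ ?rmorph1 // rpredZ // dhomog1.
Qed.

Lemma gr1M l b i : l \in gr 1 -> b \in gr i -> l * b \in gr i.+1.
Proof.
have [n [pi [_ _ grP]]] := B_std.
move=> /grP[p p1 <-] /grP[q qi <-]; apply/grP.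
by exists (p * q); rewrite ?rmorphM // (dhomogM p1 qi).
Qed.

Lemma gr_exp1M l b i t : l \in gr 1 -> b \in gr i -> l ^+ t * b \in gr (i + t).
Proof.
move=> l1 bi; elim: t => [|t IH]; first by rewrite mul1r addn0.
by rewrite exprS -mulrA addnS gr1M.
Qed.

(** Lift a basis of [B] to polynomials, and let [m] exceed their degrees. An element of degree [m]
    lifts both to a homogeneous [q] and to a combination [r] of these polynomials; the degree [m]
    component of [q - r] is [q], which lies in the kernel by homogeneity. *)
Lemma gr_big : exists N, forall n, (N <= n)%N -> gr n = 0%VS.
Proof.
have [n [pi [pi_surj pi_hom grP]]] := B_std.
have /fin_all_exists[p pE] : forall i : 'I_(\dim {:B}), exists p,
  pi p = (vbasis {:B})`_i by move=> i; apply: pi_surj.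
exists (\max_i msize (p i)) => m lem; apply/eqP; rewrite -subv0.
apply/subvP => b bm; have /grP[q qm qE] := bm.
pose r := \sum_i coord (vbasis {:B}) i b *: p i.
have rE : pi r = b.
  rewrite linear_sum [RHS](coord_vbasis (memvf b)); apply: eq_bigr => i _.
  by rewrite linearZ /= pE.
have := pi_hom (q - r) _ m.
rewrite linearB linearB /= qE rE subrr pihomog_dE // => /(_ erefl).
rewrite raddfB /= qE.
rewrite [pihomog _ _ r](_ : _ = 0) ?rmorph0 ?subr0 ?memv0 => [->//|].
rewrite linear_sum big1 // => i _; rewrite linearZ /= pihomogE big_seq_cond.
rewrite big1 ?scaler0 // => mm /andP[/msize_mdeg_lt lt /eqP E].
by have := leq_trans lt (leq_bigmax (F := fun i => msize (p i)) i);
  rewrite E ltnNge lem.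
Qed.
End StandardGraded.

(** * Multiplication by [l + x] as multiplication by ['X + 1] *)

Section Strings.
Variables (k : fieldType) (B : falgType k) (gr : nat -> {vspace B}) (d : nat).
Hypothesis d_gt0 : (0 < d)%N.
Variable l : B.
Local Notation C := {poly %/ ('X^d : {poly k})}.
Local Notation A := (tensor B C).
Local Notation grA := (tensor_grading gr (truncated_grading k d)).
Local Notation L := (lin_form d l 1).

(* [stringA U g b] is the homogenization of [U] with respect to [l] and [x],
   in degree [g], applied to [b]; [costringA V e] is the dual construction. *)
Definition stringA (U : {poly k}) (g : nat) (b : B) : A :=
  polyA d (fun z => U`_z *: (l ^+ (g - z) * b)).

Definition costringA (V : {poly k}) (e : nat) (a : A) : B :=
  \sum_(z < d) V`_z *: (l ^+ (e - z) * coefA (d.-1 - z) a).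

Lemma size_mulX1 (U : {poly k}) n :
  (size U <= n)%N -> (size (('X + 1) * U)%R <= n.+1)%N.
Proof.
move=> sU; apply: leq_trans (size_polyMleq _ _) _.
by rewrite -[1]polyC1 size_XaddC add2n.
Qed.

Lemma coef_mulX1 (U : {poly k}) z :
  (('X + 1) * U)`_z = (if z is z'.+1 then U`_z' else 0) + U`_z.
Proof. by rewrite mulrDl mul1r coefD coefXM; case: z. Qed.

Lemma stringA_step (U : {poly k}) g b : (size U <= g.+1)%N ->
  L * stringA U g b = stringA (('X + 1) * U) g.+1 b.
Proof.
move=> sU; apply: coefA_inj => // z ltz.
rewrite coefA_lin_form // scale1r !coefA_polyA // coef_mulX1 addrC scalerDl.
congr (_ + _).
  case: z ltz => [|z] ltz; first by rewrite scale0r.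
  by rewrite coefA_polyA ?subSS // ltnW.
(* For [z > g] the truncated exponent [g - z] would be wrong, but there the coefficient of [U] is
   0. *)
have [lez|ltgz] := leqP z g;
  last by rewrite nth_default ?scale0r ?mulr0 ?(leq_trans sU).
by rewrite -scalerAr mulrA -exprS subSn.
Qed.

Lemma size_mulX1_exp (U : {poly k}) g t : (size U <= g.+1)%N ->
  (size (('X + 1) ^+ t * U)%R <= (g + t).+1)%N.
Proof.
move=> sU; elim: t => [|t IH]; first by rewrite mul1r addn0.
by rewrite exprS -mulrA addnS size_mulX1.
Qed.

Lemma stringA_exp (U : {poly k}) g b t : (size U <= g.+1)%N ->
  L ^+ t * stringA U g b = stringA (('X + 1) ^+ t * U) (g + t) b.
Proof.
move=> sU; elim: t => [|t IH]; first by rewrite !mul1r addn0.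
by rewrite !exprS -!mulrA IH stringA_step ?size_mulX1_exp // addnS.
Qed.

(** [costringA V e a] is the coefficient of [x^(d-1)] in the product of the homogenization of [V]
    with [a], so a factor [l + x] can be moved from [a] to [V]. *)
Lemma costringA_step (V : {poly k}) e a : (size V <= e.+1)%N ->
  costringA V e (L * a) = costringA (('X + 1) * V) e.+1 a.
Proof.
move=> sV; pose c1 z := V`_z *: (l ^+ (e.+1 - z) * coefA (d.-1 - z) a).
pose c2 z := (if z is z'.+1 then V`_z' else 0) *:
  (l ^+ (e.+1 - z) * coefA (d.-1 - z) a).
transitivity (\sum_(z < d) c1 z + \sum_(z < d) c2 z); last first.
  rewrite -big_split; apply: eq_bigr => z _; rewrite /c1 /c2 coef_mulX1.
  by rewrite addrC scalerDl.
transitivity (\sum_(z < d) c1 z + \sum_(z < d) (V`_z *: (l ^+ (e - z) *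
  (if (d.-1 - z)%N is p'.+1 then coefA p' a else 0)))).
  rewrite -big_split; apply: eq_bigr => z _ /=; rewrite /c1.
  rewrite coefA_lin_form //; last by have := ltn_ord z; lia.
  rewrite scale1r mulrDr scalerDr mulrA -exprSr; congr (_ + _).
  have [lez|ltz] := leqP z e; first by rewrite subSn.
  by rewrite nth_default ?scale0r ?(leq_trans sV).
congr (_ + _).
(* The last term on the left and the first on the right are 0; the others match after shifting [z]
   by one. *)
suff shift n (f : nat -> B) : (0 < n)%N ->
    \sum_(z < n) V`_z *: (l ^+ (e - z) *
      (if (n.-1 - z)%N is p.+1 then f p else 0)) =
    \sum_(z < n) (if z : nat is z'.+1 then V`_z' else 0) *:
      (l ^+ (e.+1 - z) * f (n.-1 - z)%N).
  exact: (shift d (fun p => coefA p a)).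
case: n => // n _; rewrite big_ord_recr big_ord_recl /= subnn mulr0 scaler0.
rewrite addr0 scale0r add0r; apply: eq_bigr => z _;
  rewrite /bump /= add1n subSS.
by have := ltn_ord z; rewrite -subn_gt0 subnS; case: (n - z)%N.
Qed.

Lemma costringA_exp (V : {poly k}) e a t : (size V <= e.+1)%N ->
  costringA V e (L ^+ t * a) = costringA (('X + 1) ^+ t * V) (e + t) a.
Proof.
elim: t V e => [|t IH] V e sV; first by rewrite !expr0 !mul1r addn0.
rewrite exprS -mulrA costringA_step // IH ?size_mulX1 //.
by rewrite mulrA -exprSr addSnnS.
Qed.

Hypothesis B_std : standard_graded gr.
Hypothesis l1 : l \in gr 1.

Lemma mem_stringA (U : {poly k}) g b e : (size U <= g.+1)%N -> b \in gr e ->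
  stringA U g b \in grA (e + g).
Proof.
move=> sU be; apply/mem_tensor_grading => // z ltz; rewrite coefA_polyA //.
have [lez|ltgz] := leqP z g;
  last by rewrite nth_default ?scale0r ?mem0v ?(leq_trans sU).
rewrite /gr_sub (leq_trans lez) ?leq_addl // rpredZ // -addnBA //.
exact: gr_exp1M.
Qed.

(** * From the center [m] for [l] to the center [m + d - 1] for [l + x] *)

Section Descent.
Hypothesis k_char0 : [pchar k] =i pred0.
Variable m : nat.

(** The coefficients of [a] are shown to vanish from the highest power of [x] downwards. Once those
    above [x^p] are 0, a suitable [costringA] of [L ^+ t * a = 0] isolates a power of [l] times the
    coefficient of [x^p]. *)
Lemma lin_form_inj i t a :
  (forall i t b, (i + i + t <= m)%N -> b \in gr i -> l ^+ t * b = 0 -> b = 0) ->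
  (i + i + t <= m + d.-1)%N -> a \in grA i -> L ^+ t * a = 0 -> a = 0.
Proof.
move=> l_inj le_m /mem_tensor_grading a_in La0.
apply: coefA_inj => // p; rewrite linear0.
have [n] := ubnP (d - p); elim: n p => // n IH p ltn ltp.
have := a_in d_gt0 p ltp; rewrite /gr_sub; case: leqP => [lepi ap|_];
  last first.
  by rewrite memv0 => /eqP.
(* In [costringA] the coefficient of [x^p] has index [d - 1 - p]; the [p] zeros after it reach the
   last index [d - 1]. *)
have [g [V [sV gE F1 F0]]] := window_unit k_char0 t (d.-1 - p) p.
have := costringA_exp a t sV; rewrite La0 {1}/costringA big1; last first.
  by move=> z _; rewrite linear0 mulr0 scaler0.
have ltT : (d.-1 - p < d)%N by lia.
rewrite /costringA (bigD1 (Ordinal ltT)) //= F1 scale1r subKn; last by lia.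
rewrite big1 ?addr0 => [|z neT].
  move/esym; case: leqP gE => [letT gE|ltTt gE].
    by rewrite gE (_ : _ - _ = 0)%N ?mul1r //; lia.
  (* Here [g = p], and [2 (i - p)] plus the exponent of [l] equals [2 i + t - (d - 1)], which is at
     most [m]. *)
  by apply: l_inj (ap); lia.
have {}neT : (z : nat) != (d.-1 - p)%N by apply: contraNneq neT => E;
  apply/eqP/val_inj.
have [ltzT|leTz] := ltnP z (d.-1 - p).
  by rewrite IH ?mulr0 ?scaler0 //; lia.
rewrite -(subnKC leTz) F0 ?scale0r //; have := ltn_ord z; lia.
Qed.

(** The coefficients of [c] are cleared from the highest power of [x] downwards: [step] finds an
    image with the right coefficient of [x^y] and nothing above it. *)
Lemma lin_form_surj i t c :
  (forall i t c, (m < i + i + t)%N -> c \in gr (i + t) ->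
     exists2 b, b \in gr i & l ^+ t * b = c) ->
  (forall j, (m.+1 < j)%N -> gr j = 0%VS) ->
  (m + d.-1 < i + i + t)%N -> c \in grA (i + t) ->
  exists2 a, a \in grA i & L ^+ t * a = c.
Proof.
move=> l_surj gr0 lt_m c_in.
have step y c' : (y < d)%N -> c' \in grA (i + t) -> exists a,
    [/\ a \in grA i, L ^+ t * a \in grA (i + t),
        coefA y (L ^+ t * a) = coefA y c' &
        forall z, (y < z < d)%N -> coefA z (L ^+ t * a) = 0].
  move=> lty c'_in.
  have [cy0|cy_neq0] := eqVneq (coefA y c') 0.
    exists 0; rewrite mulr0 !mem0v !linear0 cy0; split=> // z _.
    by rewrite linear0.
  have := (mem_tensor_grading _ d_gt0 _ _).1 c'_in y lty.
  rewrite /gr_sub; case: leqP => [leyi cy|_]; last first.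
    by rewrite memv0 (negPf cy_neq0).
  have [g [U [sU gE F1 F0]]] := window_unit k_char0 t y (d.-1 - y).
  suff [b [b_in le_gi bE]] : exists b,
      [/\ b \in gr (i - g), (g <= i)%N & l ^+ (g + t - y) * b = coefA y c'].
    exists (stringA U g b); rewrite stringA_exp // coefA_polyA // F1 scale1r.
    split=> //; first by rewrite -(subnK le_gi) mem_stringA.
      by rewrite -(subnK le_gi) -addnA mem_stringA ?size_mulX1_exp.
    move=> z /andP[ltyz ltzd]; rewrite coefA_polyA //.
    by rewrite -(subnKC (ltnW ltyz)) F0 ?scale0r //; lia.
  case: leqP gE => [lety gE|ltyt gE].
    exists (coefA y c'); rewrite (_ : g + t - y = 0)%N ?mul1r; last by lia.
    by rewrite gE; split=> //; [rewrite (_ : _ - _ = i + t - y)%N //;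
      lia | lia].
  (* Now [g = d - 1 - y]. If [g <= i], the degrees of the source and target of the power of [l] add
     up to [2 i + t - (d - 1) > m]. Otherwise the target degree [i + t - y] exceeds [m + 1], so the
     nonzero coefficient cannot exist. *)
  have [le_gi|lt_ig] := leqP g i.
    have := l_surj (i - g)%N (g + t - y)%N (coefA y c').
    by case=> [||b b_in bE]; [lia | rewrite (_ : _ + _ = i + t - y)%N //;
      lia | exists b].
  by move: cy; rewrite gr0 ?memv0 ?(negPf cy_neq0) //; lia.
suff H y c' : (y <= d)%N -> c' \in grA (i + t) ->
    (forall z, (y <= z < d)%N -> coefA z c' = 0) ->
    exists2 a, a \in grA i & L ^+ t * a = c'.
  by apply: (H d) => // z; rewrite ltnNge; case: leqP.
elim: y c' => [|y IH] c' ley c'_in c'0.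
  exists 0; first exact: mem0v.
  by rewrite mulr0; apply: coefA_inj => // z ltz; rewrite linear0 c'0.
have [a [a_in La_in Lay La0]] := step y c' ley c'_in.
have [||z lez|a' a'_in a'E] := IH (c' - L ^+ t * a); first exact: ltnW.
- by rewrite rpredB.
- rewrite linearB /=; have [->|ney] := eqVneq z y; first by rewrite Lay subrr.
  by rewrite c'0 ?La0 ?subrr //; lia.
by exists (a + a'); rewrite ?rpredD // mulrDr a'E addrC subrK.
Qed.
End Descent.

End Strings.

(** * Failures of injectivity and surjectivity passed from [l] to [l + x] *)

Section Obstruction.
Variables (k : fieldType) (k_char0 : [pchar k] =i pred0).
Variables (B : falgType k) (gr : nat -> {vspace B}) (d : nat).
Variable l : B.
Variables (i j r : nat).
Hypotheses (ltij : (i < j)%N) (ltrd : (r < d)%N).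
Local Notation C := {poly %/ ('X^d : {poly k})}.
Local Notation A := (tensor B C).
Local Notation grA := (tensor_grading gr (truncated_grading k d)).
Local Notation L := (lin_form d l 1).
Local Notation t := (d.-1 + (j - i))%N.

Let d_gt0 : (0 < d)%N. Proof. exact: leq_ltn_trans ltrd. Qed.

(** The missed element is [c x^(d-1-r)]. For a suitable monic [V] of degree [r], [costringA l V r]
    sends it to [c], but sends every [L ^+ t * a] into [W]. *)
Lemma lin_form_not_surj c (W : {vspace B}) : c \in gr (j + r) -> c \notin W ->
  (forall e b, (e + r <= i)%N -> b \in gr e -> l ^+ (j + r - e) * b \in W) ->
  exists2 x, x \in grA (i + t) & forall a, a \in grA i -> L ^+ t * a <> x.
Proof.
move=> c_in cW imW.
have leT : (d - r <= t)%N by lia.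
(* The indices [d - r, ..., d - 1] belong to the coefficients of [x^z] with [z < r], whose degree in
   [B] is too large for the hypothesis on [W]. *)
have [V [sV Vr V0]] := window_monic k_char0 r leT.
have rE : (d.-1 - (d.-1 - r) = r)%N by lia.
exists (polyA d (fun z => if z == (d.-1 - r)%N then c else 0)).
  apply/mem_tensor_grading => // z ltz; rewrite coefA_polyA //.
  case: eqP => [->|_]; last exact: mem0v.
  by rewrite /gr_sub (_ : _ <= _)%N; [rewrite (_ : _ - _ = j + r)%N //;
    lia | lia].
move=> a a_in aE; move/negP: cW; apply.
have <- : costringA l V r (L ^+ t * a) = c.
  rewrite aE /costringA (bigD1 (Ordinal ltrd)) //= Vr scale1r subnn mul1r.
  rewrite coefA_polyA ?eqxx //; last by lia.
  rewrite big1 ?addr0 // => z nez; rewrite coefA_polyA //; last by lia.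
  case: eqP => [E|_]; last by rewrite mulr0 scaler0.
  by case/eqP: nez; apply: val_inj => /=; have := ltn_ord z; lia.
rewrite costringA_exp //; apply: rpred_sum => z _.
have [ltzT|leTz] := ltnP z (d - r); last first.
  by rewrite -(subnKC leTz) V0 ?scale0r ?mem0v //; have := ltn_ord z; lia.
rewrite rpredZ //.
have ltp : (d.-1 - z < d)%N by lia.
have := (mem_tensor_grading _ d_gt0 _ _).1 a_in _ ltp.
rewrite /gr_sub; case: leqP => [lepi b_in|_]; last first.
  by rewrite memv0 => /eqP ->; rewrite mulr0 mem0v.
rewrite (_ : r + t - z = j + r - (i - (d.-1 - z)))%N; last by lia.
by apply: imW => //; lia.
Qed.
Hypothesis B_std : standard_graded gr.
Hypothesis l1 : l \in gr 1.

(** In the string of [b] along a monic [U] of degree [r], the window kills the powers [x^z] with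
    [z >= d - r] of the image; for smaller [z] the exponent of [l] is large enough to kill [b]. *)
Lemma lin_form_not_inj b : (r <= i)%N -> b \in gr (i - r) -> b != 0 ->
  l ^+ (j - i + r + r) * b = 0 ->
  exists a, [/\ a \in grA i, a != 0 & L ^+ t * a = 0].
Proof.
move=> leri b_in nzb b0.
have leT : (d - r <= t)%N by lia.
have [U [sU Ur U0]] := window_monic k_char0 r leT.
exists (stringA d l U r b); split.
- by rewrite -(subnK leri) mem_stringA.
- apply: contraNneq nzb => /(congr1 (coefA r)).
  by rewrite coefA_polyA // Ur scale1r subnn mul1r linear0 => ->.
rewrite stringA_exp //; apply: coefA_inj => // z ltz.
rewrite coefA_polyA // linear0; have [ltzT|leTz] := ltnP z (d - r).
  rewrite -(subnK (_ : j - i + r + r <= r + t - z)%N); last by lia.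
  by rewrite [l ^+ _]exprD -mulrA b0 mulr0 scaler0.
by rewrite -(subnKC leTz) U0 ?scale0r //; lia.
Qed.

End Obstruction.

(** * The linear forms of [A] *)

Section LinearForms.
Variables (k : fieldType) (B : falgType k) (gr : nat -> {vspace B}) (d : nat).
Hypothesis B_std : standard_graded gr.
Hypothesis d_gt0 : (0 < d)%N.
Local Notation C := {poly %/ ('X^d : {poly k})}.
Local Notation A := (tensor B C).
Local Notation grA := (tensor_grading gr (truncated_grading k d)).

Lemma coefA_lin_form1 (l : B) c z : (z < d)%N ->
  coefA z (lin_form d l c) =
  match z with 0%N => l | 1%N => c%:A | _ => 0 end.
Proof.
move=> ltz; rewrite /lin_form linearD linearZ /= !coefA_pure.
have := coef_qX k d_gt0 0 z; have := coef_qX k d_gt0 1 z.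
rewrite expr0 expr1 => -> ->; rewrite ltz.
by case: z {ltz} => [|[|z]] /=;
  rewrite ?scale1r ?scale0r ?scaler0 ?addr0 ?add0r.
Qed.

Lemma mem_lin_form (l : B) c : l \in gr 1 -> lin_form d l c \in grA 1.
Proof.
move=> l1; apply/mem_tensor_grading => // z ltz; rewrite coefA_lin_form1 //.
case: z {ltz} => [|[|z]] //; rewrite /gr_sub /= ?scale0r ?mem0v //.
by apply/gr0E => //; exists c.
Qed.

Lemma lin_formP (x : A) : x \in grA 1 ->
  exists l c, l \in gr 1 /\ x = lin_form d l c.
Proof.
move=> /(mem_tensor_grading gr d_gt0 1 x) x_in.
have l1 : coefA 0 x \in gr 1 by have := x_in 0%N d_gt0.
(* For [d = 1] the class of [x] is 0 and any [c] will do. *)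
have [c cE] : exists c : k, (1 < d)%N -> coefA 1 x = c%:A.
  have [lt1d|_] := ltnP 1 d; last by exists 0.
  by have := x_in 1%N lt1d; rewrite /gr_sub /= => /(gr0E B_std)[c]; exists c.
exists (coefA 0 x), c; split=> //; apply: coefA_inj => // z ltz.
rewrite coefA_lin_form1 //; case: z ltz => [|[|z]] ltz //=; first exact: cE.
by have := x_in _ ltz; rewrite /gr_sub /= memv0 => /eqP.
Qed.

Lemma lin_form_scale (l : B) c : c != 0 ->
  lin_form d l c = c *: lin_form d (c^-1 *: l) 1.
Proof.
move=> nzc; rewrite /lin_form scalerDr tensor_pureZl !scalerA divff //.
by rewrite !scale1r mulr1.
Qed.

Lemma coefA0_exp (l : B) c t a :
  coefA 0 (lin_form d l c ^+ t * a) = l ^+ t * coefA 0 a.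
Proof.
elim: t => [|t IH]; first by rewrite !mul1r.
by rewrite !exprS -!mulrA coefA_lin_form // scaler0 addr0 IH.
Qed.
End LinearForms.

(** * Full rank and dimension counts *)

Section Multiplication.
Variables (k : fieldType) (B : falgType k).
Implicit Types (U V : {vspace B}) (u : B).

Lemma full_rank_mul_inj u U V :
  (forall b, b \in U -> u * b = 0 -> b = 0) ->
  full_rank_on (fun b => u * b) U V.
Proof.
move=> inj_u; left=> b b' bU b'U /eqP; rewrite -subr_eq0 -mulrBr => /eqP.
by move/(inj_u _ (rpredB bU b'U))/eqP; rewrite subr_eq0 => /eqP.
Qed.

Lemma mul_not_inj u U V : (forall b, b \in U -> u * b \in V) ->
  (\dim V < \dim U)%N -> exists b, [/\ b \in U, b != 0 & u * b = 0].
Proof.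
move=> uUV ltVU; have sub : (amull u @: U <= V)%VS.
  by apply/subvP => _ /memv_imgP[b bU ->]; rewrite lfunE /= uUV.
have : (U :&: lker (amull u) != 0)%VS.
  rewrite -dimv_eq0 -lt0n; have := limg_ker_dim (amull u) U.
  have := dimvS sub; lia.
rewrite -vpick0; set b := vpick _ => nzb.
have := memv_pick (U :&: lker (amull u)); rewrite -/b memv_cap memv_ker lfunE.
by move=> /andP[bU /eqP]; exists b.
Qed.

Lemma mul_not_surj u U V : (\dim U < \dim V)%N ->
  exists2 c, c \in V & c \notin (amull u @: U)%VS.
Proof.
move=> ltUV; have : ~~ (V <= amull u @: U)%VS.
  apply: contraTN ltUV => /dimvS; have := limg_ker_dim (amull u) U; lia.
by case/subvPn=> c; exists c.
Qed.

Lemma full_rank_inj u U V : (forall b, b \in U -> u * b \in V) ->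
  full_rank_on (fun b => u * b) U V -> (\dim U <= \dim V)%N ->
  forall b, b \in U -> u * b = 0 -> b = 0.
Proof.
move=> uUV [inj_u|surj_u] leUV b bU ub0.
  by apply: inj_u; rewrite ?mem0v // mulr0.
have sub : (V <= amull u @: U)%VS.
  by apply/subvP => c /surj_u[a aU <-]; apply/memv_imgP; exists a;
    rewrite ?lfunE.
have : (U :&: lker (amull u) == 0)%VS.
  rewrite -dimv_eq0; have := limg_ker_dim (amull u) U; have := dimvS sub; lia.
move=> /eqP E; apply/eqP; rewrite -memv0 -E memv_cap bU memv_ker lfunE /=.
by rewrite ub0.
Qed.

Lemma full_rank_surj u U V : (forall b, b \in U -> u * b \in V) ->
  full_rank_on (fun b => u * b) U V -> (\dim V <= \dim U)%N ->
  forall c, c \in V -> exists2 b, b \in U & u * b = c.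
Proof.
move=> uUV [inj_u|surj_u] leVU c cV; last exact: surj_u.
have : (amull u @: U == V)%VS.
  rewrite eqEdim; apply/andP; split.
    by apply/subvP => _ /memv_imgP[b bU ->]; rewrite lfunE /= uUV.
  rewrite limg_dim_eq //; apply/eqP; rewrite -subv0; apply/subvP => b.
  rewrite memv_cap memv_ker lfunE /= => /andP[bU /eqP ub0].
  by rewrite memv0; apply/eqP; apply: inj_u; rewrite ?mem0v // mulr0.
move=> /eqP E; move: cV; rewrite -E => /memv_imgP[b bU ->].
by exists b; rewrite ?lfunE.
Qed.
End Multiplication.

(** * From the SLP of all [A] to almost centeredness *)

Section Necessity.
Variables (k : fieldType) (k_char0 : [pchar k] =i pred0).
Variables (B : falgType k) (gr : nat -> {vspace B}).
Hypothesis B_std : standard_graded gr.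
Local Notation grA d := (tensor_grading gr (truncated_grading k d)).

Lemma slp_truncated1 : strong_lefschetz (grA 1) -> strong_lefschetz gr.
Proof.
move=> [x /(lin_formP B_std (ltn0Sn 0))[l [c [l1 ->]]] slp];
  exists l => // i t t_gt0.
pose A0 b : tensor B {poly %/ ('X^1 : {poly k})} := polyA 1 (fun=> b).
have A0_in j b : b \in gr j -> A0 b \in grA 1 j.
  move=> bj; apply/mem_tensor_grading => // -[|z] // lt0.
  by rewrite coefA_polyA // /gr_sub subn0.
have A0K b : coefA 0 (A0 b) = b by rewrite coefA_polyA.
have [inj|surj] := slp i t t_gt0; [left=> b b' bi b'i E|right=> b bt].
  rewrite -[b]A0K -[b']A0K; congr (coefA _ _); apply: inj; rewrite ?A0_in //.
  by apply: coefA_inj => // -[|z] // _; rewrite !coefA0_exp // !A0K.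
have [a a_in aE] := surj _ (A0_in _ _ bt).
exists (coefA 0 a); last by rewrite -(coefA0_exp _ _ c) // aE A0K.
by have := (mem_tensor_grading _ _ _ _).1 a_in 0%N isT; rewrite /gr_sub subn0;
  apply.
Qed.

(* When the coefficient of [x] vanishes, [l ^+ n] kills [1] but misses the
   nonzero class of [l ^+ n.-1 * x]. *)
Lemma slp_truncated d : (1 < d)%N -> strong_lefschetz (grA d) ->
  exists2 l, l \in gr 1 & forall i t, (1 <= t)%N ->
    full_rank_on (fun a => lin_form d l 1 ^+ t * a) (grA d i) (grA d (i + t)).
Proof.
move=> d_gt1; have d_gt0 := ltnW d_gt1.
move=> [x /(lin_formP B_std d_gt0)[l [c [l1 ->]]] slp].
have [c0|nzc] := eqVneq c 0; last first.
  exists (c^-1 *: l) => [|i t t_gt0]; first by rewrite rpredZ.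
  have := slp i t t_gt0; rewrite lin_form_scale // exprZn.
  have nzct : c ^+ t != 0 by rewrite expf_neq0.
  case=> [inj|surj]; [left=> a a' ai a'i E|right=> b bt].
    by apply: inj => //; rewrite -!scalerAl E.
  have [a ai aE] := surj (c ^+ t *: b) (rpredZ (c ^+ t) bt).
  by exists a => //; apply: (scalerI nzct); rewrite scalerAl.
rewrite {c}c0 in slp.
have coef0 z t a : (z < d)%N ->
    coefA z (lin_form d l 0 ^+ t * a) = l ^+ t * coefA z a.
  move=> ltz; elim: t => [|t IH]; first by rewrite !mul1r.
  by rewrite !exprS -!mulrA coefA_lin_form // scale0r addr0 IH.
have [N grN] := gr_big B_std.
have one0 : 1 \in gr 0 by apply/(gr0E B_std); exists 1; rewrite scale1r.
have ln0 : exists n, l ^+ n == 0.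
  exists N; have := gr_exp1M B_std N l1 one0; rewrite add0n grN // mulr1.
  by rewrite memv0.
case: (ex_minnP ln0) => -[|n] /eqP ln min_n.
  by move/eqP: ln; rewrite expr0 oner_eq0.
have nzl : l ^+ n != 0 by apply: contraTneq (ltnSn n) => E;
  rewrite -leqNgt min_n // E.
have mon_in p b i : (p < d)%N -> b \in gr i ->
    polyA d (fun z => if z == p then b else 0) \in grA d (i + p).
  move=> ltp bi; apply/mem_tensor_grading => // z ltz; rewrite coefA_polyA //.
  by case: eqP => [->|_]; rewrite ?mem0v // /gr_sub leq_addl addnK.
case: (slp 0%N n.+1 isT) => [inj|surj].
  have := inj _ 0 (mon_in 0%N 1 0%N d_gt0 one0) (mem0v _).
  have E : lin_form d l 0 ^+ n.+1 * polyA d (fun z => if z == 0%N then 1 else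
    0) =
      lin_form d l 0 ^+ n.+1 * 0.
    by apply: coefA_inj => // z ltz; rewrite !coef0 // ln !mul0r.
  move=> /(_ E)/(congr1 (coefA 0)); rewrite coefA_polyA // linear0 => /eqP.
  by rewrite oner_eq0.
have ln_in : l ^+ n \in gr n.
  by rewrite -[n in gr n]add0n -[l ^+ n]mulr1 gr_exp1M.
have := surj _ _; rewrite add0n -addn1 => /(_ _ (mon_in _ _ _ d_gt1 ln_in)).
move=> [a _ /(congr1 (coefA 1))];
  rewrite coef0 // addn1 ln mul0r coefA_polyA //.
by move/eqP; rewrite eq_sym (negPf nzl).
Qed.

(** Both inequalities compare degrees of sum [i + j]. The first yields a kernel element and the
    second a missed element for powers of [l]; once [d] exceeds [r] and [r'], they obstruct the same
    power of [l + x] on degree [i] of [A]. *)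
Lemma slp_no_crossing i j r r' : (i < j)%N ->
  (forall d, (1 <= d)%N -> strong_lefschetz (grA d)) ->
  (r <= i)%N -> (\dim (gr (j + r)) < \dim (gr (i - r)))%N ->
  ((if (r' <= i)%N then \dim (gr (i - r')) else 0) < \dim (gr (j + r')))%N ->
  False.
Proof.
move=> ltij slp leri lt_inj lt_surj.
pose d := (r + r').+2.
have [l l1 {}slp] := slp_truncated (isT : 1 < d)%N (slp d isT).
have ltrd : (r < d)%N by rewrite /d; lia.
have ltr'd : (r' < d)%N by rewrite /d; lia.
have [] := slp i (d.-1 + (j - i))%N; first by rewrite /d.
  have [|b [b_in nzb b0]] := mul_not_inj (u := l ^+ (j - i + r + r)) _ lt_inj.
    move=> b b_in; rewrite (_ : j + r = i - r + (j - i + r + r))%N; last by lia.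
    exact: gr_exp1M.
  have [a [a_in nza a0]] := lin_form_not_inj k_char0 ltij ltrd B_std l1 leri
    b_in nzb b0.
  by move=> inj; move/eqP: nza; apply; apply: inj; rewrite ?mem0v // mulr0.
move=> surj.
(* For [r' > i] the source has negative degree and must be 0, whereas truncated subtraction would
   give [gr 0]. *)
pose U := if (r' <= i)%N then gr (i - r') else 0%VS.
have [|c c_in cW] := @mul_not_surj _ _ (l ^+ (j + r' - (i - r'))) U (gr (j +
  r')).
  by move: lt_surj; rewrite /U; case: ifP; rewrite ?dimv0.
have [|x x_in x_no] := lin_form_not_surj k_char0 (l := l) ltij ltr'd c_in cW.
  move=> e b le_e b_in; have ler'i : (r' <= i)%N by lia.
  apply/memv_imgP; exists (l ^+ (i - r' - e) * b).
    rewrite /U ler'i -{2}(subnKC (_ : e <= i - r')%N); last by lia.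
    exact: gr_exp1M.
  by rewrite lfunE /= mulrA -exprD; congr (_ ^+ _ * _); lia.
by have [a a_in /x_no] := surj x x_in; apply.
Qed.

(** A violation of either clause is a rise and a drop of equal sum, as excluded by
    [slp_no_crossing]. The outer pair takes [s], the inner one 0; only an outer rise may start in
    negative degree. *)
Lemma slp_almost_centered :
  (forall d, (1 <= d)%N -> strong_lefschetz (grA d)) -> almost_centered gr.
Proof.
move=> slp.
have h_neg x : (x < 0)%R -> hilbert gr x = 0%N by case: x.
have hE x (n : nat) : x = n%:Z -> hilbert gr x = \dim (gr n) by move=> ->.
split=> i j ltij hij s; rewrite leqNgt; apply/negP => hs.
  have le_si : (s%:Z <= i)%R.
    by rewrite Order.TotalTheory.leNgt; apply/negP => lt;
      rewrite (h_neg (i - s%:Z)) // in hs; lia.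
  have [i' iE] : exists i' : nat, i = i'%:Z by exists (absz i); lia.
  have [j' jE] : exists j' : nat, j = j'%:Z by exists (absz j); lia.
  apply: (@slp_no_crossing i' j' s 0 _ slp); first by lia.
  - by lia.
  - by rewrite -(hE (i - s%:Z) (i' - s)%N) -?(hE (j + s%:Z) (j' + s)%N) //; lia.
  - by rewrite /= subn0 addn0 -(hE i i') -?(hE j j').
have le_i : (0 <= i)%R.
  by rewrite Order.TotalTheory.leNgt; apply/negP => lt;
    rewrite (h_neg i) // in hij.
have [i' iE] : exists i' : nat, i = i'%:Z by exists (absz i); lia.
have [j' jE] : exists j' : nat, j = j'%:Z by exists (absz j); lia.
apply: (@slp_no_crossing i' j' 0 s _ slp); first by lia.
- by [].
- by rewrite subn0 addn0 -(hE i i') -?(hE j j').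
rewrite -(hE (j + s%:Z) (j' + s)%N); last by lia.
case: (leqP s i') => [le_si|lt_is];
  first by rewrite -(hE (i - s%:Z) (i' - s)%N) //; lia.
exact: leq_ltn_trans hs.
Qed.
End Necessity.

(** * From an almost centered [B] with the SLP to the SLP of [A] *)

Section Sufficiency.
Variables (k : fieldType) (k_char0 : [pchar k] =i pred0).
Variables (B : falgType k) (gr : nat -> {vspace B}).
Hypothesis B_std : standard_graded gr.
Local Notation grA d := (tensor_grading gr (truncated_grading k d)).

Lemma almost_centered_slp d : (1 <= d)%N ->
  almost_centered gr -> strong_lefschetz gr -> strong_lefschetz (grA d).
Proof.
move=> d_gt0 [h_up h_down] [l l1 slp].
have [N grN] := gr_big B_std.
have [||m center] := almost_centered_center _ h_up h_down (N := N).
- by case.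
- by case=> // n leN; rewrite /= grN ?dimv0.
have slp_in i t b : b \in gr i -> l ^+ t * b \in gr (i + t).
  exact: gr_exp1M.
have l_inj i t b : (i + i + t <= m)%N -> b \in gr i -> l ^+ t * b = 0 -> b = 0.
  case: t => [|t] le_m; first by rewrite mul1r.
  apply: full_rank_inj (slp i t.+1 isT) _ b => [b|]; first exact: slp_in.
  by apply: (center i (i + t.+1)%N _).1; lia.
have l_surj i t c : (m < i + i + t)%N -> c \in gr (i + t) ->
    exists2 b, b \in gr i & l ^+ t * b = c.
  case: t => [|t] lt_m; first by rewrite addn0 => ci; exists c; rewrite ?mul1r.
  apply: full_rank_surj (slp i t.+1 isT) _ c => [b|]; first exact: slp_in.
  by apply: (center i (i + t.+1)%N _).2; lia.
have gr_0 j : (m.+1 < j)%N -> gr j = 0%VS.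
  move=> lt_mj; apply/eqP; rewrite -dimv_eq0 -leqn0.
  (* The pair [-1 < j] has sum greater than [m], and [h] is 0 at [-1]. *)
  by apply: (center (-1) j%:Z _).2; lia.
exists (lin_form d l 1) => [|i t _]; first exact: mem_lin_form.
have [le_m|lt_m] := leqP (i + i + t) (m + d.-1).
  by apply: full_rank_mul_inj => a; apply: lin_form_inj le_m.
by right=> c; apply: lin_form_surj lt_m.
Qed.
End Sufficiency.

Theorem theorem5p5 (k : fieldType) (k_char0 : [pchar k] =i pred0)
    (B : falgType k) (gr : nat -> {vspace B}) (B_std : standard_graded gr) :
  (forall d : nat, (1 <= d)%N ->
     strong_lefschetz (tensor_grading gr (truncated_grading k d))) <->
  almost_centered gr /\ strong_lefschetz gr.
Proof.
split=> [slp|[ac slp] d d_gt0]; last exact: almost_centered_slp.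
by split; [exact: slp_almost_centered | exact: slp_truncated1 (slp 1%N isT)].
Qed.
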